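(* Let $J:\mathcal{X}\to[0,\infty]$ be a convex one-homogeneous functional on the real Banach space $\mathcal{X}$. For $u,v\in\mathcal{X}$ and a subgradient $p(v)\in\partial J(v)$ set $$\lfloor u,v\rfloor_J^{p(v)} := \langle u,p(v)\rangle,$$ and let $\{\lfloor u,v\rfloor_J\}:=\{\langle u,p\rangle : p\in\partial J(v)\}$ be the corresponding set of admissible values. Then this is a semi-inner-product of $J$ of degree $1/2$, i.e. for all $u,u_1,u_2,v\in\mathcal{X}$ and $\alpha\in\mathbb{R}$, where $\lfloor\cdot,\cdot\rfloor_J$ stands for an arbitrary element of the corresponding set $\{\lfloor\cdot,\cdot\rfloor_J\}$: 1. (Linearity in the first argument) $\lfloor u_1+u_2,v\rfloor_J=s+r$ for some $s\in\{\lfloor u_1,v\rfloor_J\}$ and $r\in\{\lfloor u_2,v\rfloor_J\}$; 2. (Homogeneity in the first argument) $\lfloor\alpha u,v\rfloor_J\in\{\alpha\lfloor u,v\rfloor_J\}$; 3. (Functional-inducing) $\lfloor u,u\rfloor_J=J(u)$; 4. (Cauchy-Schwarz-type inequality) $\sqrt{|\lfloor u,v\rfloor_J\cdot\lfloor v,u\rfloor_J|}\le J^{1/2}(u)\,J^{1/2}(v)$.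
   Context: $\mathcal{X}$ is a real Banach space (of functions) with dual $\mathcal{X}^*$; $\langle\cdot,\cdot\rangle$ denotes the $L^2$ inner product, used as the pairing between $\mathcal{X}$ and $\mathcal{X}^*$. $J:\mathcal{X}\to[0,\infty]$ is proper, convex and lower semi-continuous. One-homogeneous means $J(\alpha u)=|\alpha|J(u)$ for all $\alpha\in\mathbb{R}$, $u\in\mathcal{X}$. It is assumed throughout that $J(u)>0$ for $u\in\mathcal{X}\setminus\{0\}$. The subdifferential is $\partial J(u)=\{p\in\mathcal{X}^* : J(v)-J(u)\ge\langle p,v-u\rangle\ \forall v\in\mathcal{X}\}$; its elements are called subgradients and $p(u)$ denotes an element of $\partial J(u)$. The semi-inner-product is allowed to be set-valued: $\{\lfloor u,v\rfloor_J\}$ denotes the set of admissible values and $\lfloor u,v\rfloor_J$ an element of it; $\{\alpha\lfloor u,v\rfloor_J\}$ denotes $\{\alpha s : s\in\{\lfloor u,v\rfloor_J\}\}$. Statements about elements of a set are vacuous when the set is empty. *)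

(* Defs.v *)
From HB Require Import structures.
From mathcomp Require Import all_boot all_order all_algebra.
From mathcomp Require Import all_classical all_reals all_analysis.
Import Order.TTheory GRing.Theory Num.Theory.
Import numFieldNormedType.Exports.

Set Implicit Arguments.
Unset Strict Implicit.
Unset Printing Implicit Defensive.

Local Open Scope classical_set_scope.
Local Open Scope ring_scope.
Local Open Scope ereal_scope.

Section functionals.
Context {R : realType} {X : normedModType R}.
Implicit Types (J : X -> \bar R) (u v : X).

(* With the convention 0 * +oo = 0, the case a = 0 says that J 0 = 0. *)
Definition one_homogeneous J :=
  forall (a : R) u, J (a *: u)%R = `|a|%:E * J u.

Definition convex_functional J :=
  forall (t : R) u v, (0 <= t <= 1)%R ->
    J (t *: u + (1 - t) *: v)%R <= t%:E * J u + (1 - t)%:E * J v.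

(* Only used for functionals with values in [0, +oo], so that the value -oo
   need not be excluded. *)
Definition proper_functional J := exists u, J u < +oo.

Definition dual_space : set {scalar X} :=
  [set p | continuous (p : X -> R)].

(* For a space of functions whose dual is represented through the L^2 inner
   product, p is the functional u |-> <u, p>. *)
Definition pairing u (p : {scalar X}) : R := p u.

(* Outside the effective domain the set is empty: +oo - +oo = -oo, so the
   inequality fails at v = u when J u = +oo. *)
Definition subdifferential J u : set {scalar X} :=
  [set p | dual_space p /\
           forall v, (pairing (v - u)%R p)%:E <= J v - J u].

Definition sip_at u (p : {scalar X}) : R := pairing u p.

Definition sip J u v : set R := [set sip_at u p | p in subdifferential J v].

End functionals.

(* Main.v *)
Require Import Defs.
From HB Require Import structures.
From mathcomp Require Import all_boot all_order all_algebra.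
From mathcomp Require Import all_classical all_reals all_analysis.
From mathcomp Require Import lra.
Import Order.TTheory GRing.Theory Num.Theory.
Import numFieldNormedType.Exports.

(** A subgradient [p] of a one-homogeneous functional [J] at [v] is a linear
    functional dominated by [J] that touches [J] at [v].  Testing the
    subgradient inequality at [0] and at [2 v] gives [p v = J v]
    ([subgradient_self]): these are the two directions of the ray through [v],
    along which [J] is linear.  Subtracting this equality from the subgradient
    inequality leaves [p w <= J w] for every [w], and evenness of [J] turns it
    into [|p w| <= J w] ([subgradient_abs_le]).

    The first fact is the functional-inducing property.  The second bounds
    [<u, p(v)>] by [J u] and [<v, p(u)>] by [J v]; multiplying and taking
    square roots gives the Cauchy-Schwarz inequality.  Additivity and
    homogeneity in the first argument hold because one fixed subgradient can be
    used on both sides. *)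

Local Open Scope classical_set_scope.
Local Open Scope ring_scope.

Section subgradients.
Context {R : realType} {X : normedModType R}.
Variable J : X -> \bar R.
Hypothesis J_ge0 : forall u : X, (0 <= J u)%E.
Hypothesis J_homog : one_homogeneous J.

Lemma homog0 : J 0 = 0%E.
Proof. by have := J_homog 0 0; rewrite scale0r normr0 mul0e. Qed.

Lemma homogN u : J (- u) = J u.
Proof. by rewrite -scaleN1r J_homog normrN1 mul1e. Qed.

(** If [J v = +oo], the subgradient inequality at [v] itself reads
    [0 <= +oo - +oo], and that difference is [-oo]. *)
Lemma subgradient_fin_num {v p} : subdifferential J v p -> J v \is a fin_num.
Proof.
move=> [_ /(_ v)]; move: (J_ge0 v).
by case: (J v) => [x| |] //=; rewrite leNgt ltNyr.
Qed.

(** At [0] the subgradient inequality reads [- p v <= - J v], at [2 v] it reads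
    [p v <= J v]. *)
Lemma subgradient_self {v p} : subdifferential J v p -> (p v)%:E = J v.
Proof.
move=> vp; have /fineK Jv := subgradient_fin_num vp; case: vp => _ vp.
have := vp 0; have := vp (2 *: v).
rewrite homog0 J_homog -Jv /pairing sub0r raddfN /= scaler_nat mulr2n addrK.
rewrite -EFinM -!EFinB !lee_fin ger0_norm// => le_pv ge_pv.
by congr EFin; lra.
Qed.

Lemma subgradient_le {v p} w : subdifferential J v p -> ((p w)%:E <= J w)%E.
Proof.
move=> vp; have pv := subgradient_self vp; case: vp => _ /(_ w).
by rewrite /pairing -pv raddfB /= EFinB leeD2rE.
Qed.

(** Linearity of [p] and evenness of [J] give the bound at [w] and [- w]
    simultaneously. *)
Lemma subgradient_abs_le {v p} w : subdifferential J v p -> (`|p w|%:E <= J w)%E.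
Proof.
move=> vp; have := subgradient_le (- w) vp; have := subgradient_le w vp.
by rewrite homogN raddfN /=; case: (ger0P (p w)).
Qed.

Lemma sip_self u w : sip J u u w -> w%:E = J u.
Proof. by move=> [p up <-]; exact: subgradient_self. Qed.

Lemma sip_cauchy_schwarz u v s r : sip J u v s -> sip J v u r ->
  ((Num.sqrt `|s * r|)%:E <= J u `^ 2^-1 * J v `^ 2^-1)%E.
Proof.
move=> [p vp <-] [q uq <-]; rewrite /sip_at /pairing.
have := subgradient_abs_le u vp; have := subgradient_abs_le v uq.
(* Both sets of values are nonempty, so [J u] and [J v] are finite and the
   inequality can be read in the reals. *)
have /fineK <- := subgradient_fin_num vp.
have /fineK <- := subgradient_fin_num uq.
have Ju_ge0 := fine_ge0 (J_ge0 u); have Jv_ge0 := fine_ge0 (J_ge0 v).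
rewrite !poweR_EFin -EFinM !lee_fin !powR12_sqrt// -sqrtrM// => qv pu.
by rewrite ler_wsqrtr// normrM ler_pM.
Qed.

End subgradients.

Lemma sip_additive (R : realType) (X : normedModType R) (J : X -> \bar R)
    (u1 u2 v : X) (w : R) : sip J (u1 + u2) v w ->
  exists s r : R, [/\ sip J u1 v s, sip J u2 v r & w = s + r].
Proof.
move=> [p vp <-]; exists (p u1), (p u2).
by split; [exists p | exists p | exact: raddfD].
Qed.

Lemma sip_homogeneous (R : realType) (X : normedModType R) (J : X -> \bar R)
    (a : R) (u v : X) (w : R) :
  sip J (a *: u) v w -> [set a * s | s in sip J u v] w.
Proof.
move=> [p vp <-]; exists (p u); first by exists p.
by rewrite /sip_at /pairing linearZ.
Qed.

Theorem proposition1 (R : realType) (X : completeNormedModType R)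
    (J : X -> \bar R)
    (J_ge0 : forall u : X, (0 <= J u)%E)
    (J_proper : proper_functional J)
    (J_convex : convex_functional J)
    (J_lsc : lower_semicontinuous J)
    (J_homog : one_homogeneous J)
    (J_gt0 : forall u : X, u <> 0 -> (0 < J u)%E) :
  (forall (u1 u2 v : X) (w : R), sip J (u1 + u2) v w ->
     exists s r : R, [/\ sip J u1 v s, sip J u2 v r & w = s + r]) /\
  (forall (a : R) (u v : X) (w : R), sip J (a *: u) v w ->
     [set a * s | s in sip J u v] w) /\
  (forall (u : X) (w : R), sip J u u w -> w%:E = J u) /\
  (forall (u v : X) (s r : R), sip J u v s -> sip J v u r ->
     ((Num.sqrt `|s * r|)%:E <= J u `^ 2^-1 * J v `^ 2^-1)%E).
Proof.
split; first exact: sip_additive.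
split; first exact: sip_homogeneous.
split; first exact: sip_self.
exact: sip_cauchy_schwarz.
Qed.
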